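(* Let $\mathcal{B}$ be a cartesian bicategory with enough maps. Then $\mathcal{B}$ satisfies the axiom of choice if and only if $\mathcal{B}$ is isomorphic, as a cartesian bicategory, to $\mathrm{Span}^{\sim}(\mathrm{Map}(\mathcal{B}))$ (the latter being defined, i.e. $\mathrm{Map}(\mathcal{B})$ having finite products and weak pullbacks).
   Context: Composition is written in diagrammatic order: for $R\colon X\to Y$, $S\colon Y\to Z$, $R;S\colon X\to Z$. A cartesian bicategory is a (strict) symmetric monoidal category $(\mathcal{B},\otimes,I)$ with symmetry $\sigma$, enriched over posets (each hom-set is partially ordered by $\le$, and $;$ and $\otimes$ are monotone), in which every object $X$ carries morphisms $\delta_X\colon X\to X\otimes X$, $\varepsilon_X\colon X\to I$ such that: (1) $(X,\delta_X,\varepsilon_X)$ is a cocommutative comonoid; (2) $\delta_X,\varepsilon_X$ have right adjoints $\delta_X^*\colon X\otimes X\to X$, $\varepsilon_X^*\colon I\to X$: $\mathrm{id}_X\le\delta_X;\delta_X^*$, $\delta_X^*;\delta_X\le \mathrm{id}_{X\otimes X}$, $\mathrm{id}_X\le \varepsilon_X;\varepsilon_X^*$, $\varepsilon_X^*;\varepsilon_X\le\mathrm{id}_I$; (3) Frobenius law $\delta_X^*;\delta_X=(\mathrm{id}_X\otimes\delta_X);(\delta_X^*\otimes\mathrm{id}_X)$; (4) every $R\colon X\to Y$ satisfies $R;\delta_Y\le\delta_X;(R\otimes R)$ and $R;\varepsilon_Y\le\varepsilon_X$; (5) $\varepsilon_{X\otimes Y}=\varepsilon_X\otimes\varepsilon_Y$,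 $\delta_{X\otimes Y}=(\delta_X\otimes\delta_Y);(\mathrm{id}_X\otimes\sigma_{X,Y}\otimes\mathrm{id}_Y)$, $\varepsilon_I=\mathrm{id}_I$, $\delta_I=\mathrm{id}_I$. A morphism of cartesian bicategories is a monoidal functor preserving the order and the chosen $\delta,\varepsilon,\delta^*,\varepsilon^*$; an isomorphism is such a morphism with an inverse morphism. For $R\colon X\to Y$, its opposite is $R^{op}\colon Y\to X$, $R^{op}=(\mathrm{id}_Y\otimes(\varepsilon_X^*;\delta_X));(\mathrm{id}_Y\otimes R\otimes\mathrm{id}_X);((\delta_Y^*;\varepsilon_Y)\otimes\mathrm{id}_X)$. $R$ is single valued if $\delta_X;(R\otimes R)\le R;\delta_Y$, total if $\varepsilon_X\le R;\varepsilon_Y$. A map is a single valued total morphism; $\mathrm{Map}(\mathcal{B})$ is the category of objects of $\mathcal{B}$ and maps (it is cartesian with product $\otimes$ and terminal object $I$). $\mathcal{B}$ satisfies the axiom of choice if for every total $R\colon X\to Y$ there is a map $f\colon X\to Y$ with $f\le R$. $\mathcal{B}$ has enough maps if for every morphism $R\colon X\to I$ there is a map $f\colon Z\to X$ with $R=f^{op};\varepsilon_Z$. A weak pullback of $h\colon B\to D$, $k\colon C\to D$ is a commutative square $f;h=g;k$ ($f\colon A\to B$, $g\colon A\to C$) such that for all $b\colon T\to B$, $c\colon T\to C$ with $b;h=c;k$ there exists some (not necessarily unique) $t\colon T\to A$ with $t;f=b$, $t;g=c$. For a category $\mathcal{C}$ with finite products and weak pullbacks, $\mathrm{Span}^{\sim}(\mathcal{C})$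 is defined as follows. A span $X\leftarrow A\to Y$ is a pair of arrows of $\mathcal{C}$; set $(X\xleftarrow{} A\to Y)\le(X\leftarrow B\to Y)$ iff there is $\alpha\colon A\to B$ commuting with both legs, and $s_1\sim s_2$ iff $s_1\le s_2\le s_1$. Objects are those of $\mathcal{C}$; morphisms $X\to Y$ are $\sim$-classes of spans, ordered by $\le$; composition of $X\leftarrow A\xrightarrow{f}Y$ and $Y\xleftarrow{g}B\to Z$ is $X\leftarrow P\to Z$ for any weak pullback $P$ of $f,g$; identities are $X\xleftarrow{\mathrm{id}}X\xrightarrow{\mathrm{id}}X$; $\otimes$ is the product of $\mathcal{C}$ (legwise) with unit the terminal object; $\delta_X$ is the class of $X\xleftarrow{\mathrm{id}}X\xrightarrow{\Delta}X\times X$, $\varepsilon_X$ of $X\xleftarrow{\mathrm{id}}X\to 1$, and $\delta_X^*,\varepsilon_X^*$ are the reversed spans. This is a cartesian bicategory. *)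

(* Defs.v *)
(* Composition is written in diagrammatic order throughout. *)
From Stdlib Require Import ssreflect ssrfun.
From Stdlib Require Import ProofIrrelevance.

Set Implicit Arguments.
Unset Strict Implicit.
Unset Printing Implicit Defensive.

Declare Scope cb_scope.
Delimit Scope cb_scope with cb.
Open Scope cb_scope.

(* The operations are separated from the axioms: "isomorphic as cartesian
   bicategories" only refers to the operations, so that an isomorphism makes
   sense between any two such structures, and transports the axioms. *)
Record cbData := CbData {
  ob :> Type;
  hom : ob -> ob -> Type;
  hle : forall X Y, hom X Y -> hom X Y -> Prop;
  idm : forall X, hom X X;
  comp : forall X Y Z, hom X Y -> hom Y Z -> hom X Z;
  tens : ob -> ob -> ob;
  unit : ob;
  tensm : forall X Y X' Y', hom X Y -> hom X' Y' -> hom (tens X X') (tens Y Y');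
  sym : forall X Y, hom (tens X Y) (tens Y X);
  copy : forall X, hom X (tens X X);          (* delta *)
  discard : forall X, hom X unit;             (* epsilon *)
  cocopy : forall X, hom (tens X X) X;        (* delta^* *)
  codiscard : forall X, hom unit X            (* epsilon^* *)
}.

Arguments hom {c} X Y.
Arguments hle {c X Y} f g.
Arguments idm {c} X.
Arguments comp {c X Y Z} f g.
Arguments tens {c} X Y.
Arguments unit {c}.
Arguments tensm {c X Y X' Y'} f g.
Arguments sym {c} X Y.
Arguments copy {c} X.
Arguments discard {c} X.
Arguments cocopy {c} X.
Arguments codiscard {c} X.

Notation "f ≼ g" := (hle f g) (at level 70, no associativity) : cb_scope.
Notation "f ;; g" := (comp f g) (at level 50, left associativity) : cb_scope.
Notation "X ⊗ Y" := (tens X Y) (at level 40, left associativity) : cb_scope.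
Notation "f ⊠ g" := (tensm f g) (at level 40, left associativity) : cb_scope.

(* Transport of a morphism along equalities between its end points. Strict
   associativity and unitality are equalities of objects, so equations between
   morphisms that use them are stated up to [castm]. *)
Definition castm (B : cbData) (X X' Y Y' : B) (eX : X = X') (eY : Y = Y')
    (f : hom X Y) : hom X' Y' :=
  match eX in _ = U, eY in _ = V return hom U V with
  | eq_refl, eq_refl => f
  end.

Record isStrictSMPos (B : cbData) : Prop := IsStrictSMPos {
  hle_refl : forall (X Y : B) (f : hom X Y), f ≼ f;
  hle_trans : forall (X Y : B) (f g h : hom X Y), f ≼ g -> g ≼ h -> f ≼ h;
  hle_anti : forall (X Y : B) (f g : hom X Y), f ≼ g -> g ≼ f -> f = g;

  comp1m : forall (X Y : B) (f : hom X Y), idm X ;; f = f;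
  compm1 : forall (X Y : B) (f : hom X Y), f ;; idm Y = f;
  compA : forall (X Y Z W : B) (f : hom X Y) (g : hom Y Z) (h : hom Z W),
    f ;; (g ;; h) = f ;; g ;; h;
  comp_mono : forall (X Y Z : B) (f f' : hom X Y) (g g' : hom Y Z),
    f ≼ f' -> g ≼ g' -> f ;; g ≼ f' ;; g';

  tensm_id : forall X Y : B, idm X ⊠ idm Y = idm (X ⊗ Y);
  tensm_comp : forall (X Y Z X' Y' Z' : B) (f : hom X Y) (g : hom Y Z)
      (f' : hom X' Y') (g' : hom Y' Z'),
    (f ;; g) ⊠ (f' ;; g') = (f ⊠ f') ;; (g ⊠ g');
  tensm_mono : forall (X Y X' Y' : B) (f g : hom X Y) (f' g' : hom X' Y'),
    f ≼ g -> f' ≼ g' -> f ⊠ f' ≼ g ⊠ g';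

  tensA : forall X Y Z : B, X ⊗ (Y ⊗ Z) = X ⊗ Y ⊗ Z;
  tens1 : forall X : B, unit ⊗ X = X;
  tensX1 : forall X : B, X ⊗ unit = X;
  tensmA : forall (X Y X' Y' X'' Y'' : B)
      (f : hom X Y) (g : hom X' Y') (h : hom X'' Y''),
    castm (tensA X X' X'') (tensA Y Y' Y'') (f ⊠ (g ⊠ h)) = f ⊠ g ⊠ h;
  tensm1 : forall (X Y : B) (f : hom X Y),
    castm (tens1 X) (tens1 Y) (idm unit ⊠ f) = f;
  tensmX1 : forall (X Y : B) (f : hom X Y),
    castm (tensX1 X) (tensX1 Y) (f ⊠ idm unit) = f;

  symK : forall X Y : B, sym X Y ;; sym Y X = idm (X ⊗ Y);
  sym_nat : forall (X Y X' Y' : B) (f : hom X Y) (g : hom X' Y'),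
    (f ⊠ g) ;; sym Y Y' = sym X X' ;; (g ⊠ f);
  sym_hex : forall X Y Z : B,
    sym X (Y ⊗ Z) =
      castm (eq_sym (tensA X Y Z)) (tensA Y Z X)
        (castm eq_refl (eq_sym (tensA Y X Z)) (sym X Y ⊠ idm Z)
         ;; (idm Y ⊠ sym X Z))
}.

Definition tens_mid (B : cbData) (sB : isStrictSMPos B) (X Z Z' Y : B) :
    (X ⊗ Z) ⊗ (Z' ⊗ Y) = X ⊗ ((Z ⊗ Z') ⊗ Y) :=
  eq_trans (eq_sym (tensA sB X Z (Z' ⊗ Y)))
           (f_equal (tens X) (tensA sB Z Z' Y)).

(* id_X ⊗ σ_{Z,Z'} ⊗ id_Y *)
Definition swap_mid (B : cbData) (sB : isStrictSMPos B) (X Z Z' Y : B) :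
    hom ((X ⊗ Z) ⊗ (Z' ⊗ Y)) ((X ⊗ Z') ⊗ (Z ⊗ Y)) :=
  castm (eq_sym (tens_mid sB X Z Z' Y)) (eq_sym (tens_mid sB X Z' Z Y))
    (idm X ⊠ (sym Z Z' ⊠ idm Y)).

Record isCartBicat (B : cbData) : Prop := IsCartBicat {
  cb_smpos :> isStrictSMPos B;

  copyA : forall X : B,
    castm eq_refl (tensA cb_smpos X X X) (copy X ;; (idm X ⊠ copy X)) =
      copy X ;; (copy X ⊠ idm X);
  copy1 : forall X : B,
    castm eq_refl (tens1 cb_smpos X) (copy X ;; (discard X ⊠ idm X)) = idm X;
  copyX1 : forall X : B,
    castm eq_refl (tensX1 cb_smpos X) (copy X ;; (idm X ⊠ discard X)) = idm X;
  copyC : forall X : B, copy X ;; sym X X = copy X;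

  copy_unit : forall X : B, idm X ≼ copy X ;; cocopy X;
  copy_counit : forall X : B, cocopy X ;; copy X ≼ idm (X ⊗ X);
  discard_unit : forall X : B, idm X ≼ discard X ;; codiscard X;
  discard_counit : forall X : B, codiscard X ;; discard X ≼ idm unit;

  frobenius : forall X : B,
    cocopy X ;; copy X =
      castm eq_refl (tensA cb_smpos X X X) (idm X ⊠ copy X)
      ;; (cocopy X ⊠ idm X);

  copy_lax : forall (X Y : B) (R : hom X Y), R ;; copy Y ≼ copy X ;; (R ⊠ R);
  discard_lax : forall (X Y : B) (R : hom X Y), R ;; discard Y ≼ discard X;

  discard_tens : forall X Y : B,
    discard (X ⊗ Y) = castm eq_refl (tens1 cb_smpos unit)
                        (discard X ⊠ discard Y);
  copy_tens : forall X Y : B,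
    copy (X ⊗ Y) = (copy X ⊠ copy Y) ;; swap_mid cb_smpos X X Y Y;
  discard1 : discard (unit : B) = idm unit;
  copy_unit1 : copy (unit : B) =
    castm eq_refl (eq_sym (tens1 cb_smpos unit)) (idm unit)
}.

Record cartBicat := CartBicat {
  cb_data :> cbData;
  cb_axioms : isCartBicat cb_data
}.

(* The monoidal structures are strict, and so are the monoidal functors; they
   also preserve the symmetry, as functors between symmetric monoidal
   categories do (here this also follows from the other clauses). *)
Record cbMorphism (B C : cbData) := CbMorphism {
  fob :> B -> C;
  fhom : forall X Y : B, hom X Y -> hom (fob X) (fob Y);
  fhom_le : forall (X Y : B) (f g : hom X Y), f ≼ g -> fhom f ≼ fhom g;
  fhom_id : forall X : B, fhom (idm X) = idm (fob X);
  fhom_comp : forall (X Y Z : B) (f : hom X Y) (g : hom Y Z),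
    fhom (f ;; g) = fhom f ;; fhom g;
  fob_tens : forall X Y : B, fob (X ⊗ Y) = fob X ⊗ fob Y;
  fob_unit : fob unit = unit;
  fhom_tens : forall (X Y X' Y' : B) (f : hom X Y) (g : hom X' Y'),
    castm (fob_tens X X') (fob_tens Y Y') (fhom (f ⊠ g)) = fhom f ⊠ fhom g;
  fhom_sym : forall X Y : B,
    castm (fob_tens X Y) (fob_tens Y X) (fhom (sym X Y)) = sym (fob X) (fob Y);
  fhom_copy : forall X : B,
    castm eq_refl (fob_tens X X) (fhom (copy X)) = copy (fob X);
  fhom_discard : forall X : B,
    castm eq_refl fob_unit (fhom (discard X)) = discard (fob X);
  fhom_cocopy : forall X : B,
    castm (fob_tens X X) eq_refl (fhom (cocopy X)) = cocopy (fob X);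
  fhom_codiscard : forall X : B,
    castm fob_unit eq_refl (fhom (codiscard X)) = codiscard (fob X)
}.

Definition compIsId (B C : cbData) (F : cbMorphism B C) (G : cbMorphism C B) :
    Prop :=
  exists e : forall X : B, G (F X) = X,
    forall (X Y : B) (f : hom X Y), castm (e X) (e Y) (fhom G (fhom F f)) = f.

Definition isomorphic (B C : cbData) : Prop :=
  exists (F : cbMorphism B C) (G : cbMorphism C B),
    compIsId F G /\ compIsId G F.

Definition single_valued (B : cbData) (X Y : B) (R : hom X Y) : Prop :=
  copy X ;; (R ⊠ R) ≼ R ;; copy Y.

Definition total (B : cbData) (X Y : B) (R : hom X Y) : Prop :=
  discard X ≼ R ;; discard Y.

Definition is_map (B : cbData) (X Y : B) (R : hom X Y) : Prop :=
  single_valued R /\ total R.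

Definition opposite (B : cartBicat) (X Y : B) (R : hom X Y) : hom Y X :=
  let sB : isStrictSMPos B := cb_axioms B in
  castm (tensX1 sB Y) eq_refl (idm Y ⊠ (codiscard X ;; copy X))
  ;; castm eq_refl (tensA sB Y Y X) (idm Y ⊠ (R ⊠ idm X))
  ;; castm eq_refl (tens1 sB X) ((cocopy Y ;; discard Y) ⊠ idm X).

Definition axiomOfChoice (B : cartBicat) : Prop :=
  forall (X Y : B) (R : hom X Y), total R ->
    exists f : hom X Y, is_map f /\ f ≼ R.

Definition enoughMaps (B : cartBicat) : Prop :=
  forall (X : B) (R : hom X unit),
    exists (Z : B) (f : hom Z X), is_map f /\ R = opposite f ;; discard Z.

Record category := Category {
  cob :> Type;
  arr : cob -> cob -> Type;
  ida : forall X, arr X X;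
  cmp : forall X Y Z, arr X Y -> arr Y Z -> arr X Z;
  cmp1a : forall X Y (f : arr X Y), cmp (ida X) f = f;
  cmpa1 : forall X Y (f : arr X Y), cmp f (ida Y) = f;
  cmpA : forall X Y Z W (f : arr X Y) (g : arr Y Z) (h : arr Z W),
    cmp f (cmp g h) = cmp (cmp f g) h
}.

Arguments arr {c} X Y.
Arguments ida {c} X.
Arguments cmp {c X Y Z} f g.

Notation "f · g" := (cmp f g) (at level 50, left associativity) : cb_scope.

Record finProducts (C : category) := FinProducts {
  prd : C -> C -> C;
  pr1 : forall X Y, arr (prd X Y) X;
  pr2 : forall X Y, arr (prd X Y) Y;
  pairing : forall T X Y : C, arr T X -> arr T Y -> arr T (prd X Y);
  pairing1 : forall (T X Y : C) (f : arr T X) (g : arr T Y),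
    pairing f g · pr1 X Y = f;
  pairing2 : forall (T X Y : C) (f : arr T X) (g : arr T Y),
    pairing f g · pr2 X Y = g;
  pairing_uniq : forall (T X Y : C) (h : arr T (prd X Y)),
    pairing (h · pr1 X Y) (h · pr2 X Y) = h;
  term : C;
  bang : forall X : C, arr X term;
  bang_uniq : forall (X : C) (f : arr X term), f = bang X
}.

Arguments prd {C} f X Y : rename.
Arguments pr1 {C} f X Y : rename.
Arguments pr2 {C} f X Y : rename.
Arguments pairing {C} f {T X Y} _ _ : rename.
Arguments term {C} f : rename.
Arguments bang {C} f X : rename.

Definition prdm (C : category) (P : finProducts C) (X Y X' Y' : C)
    (f : arr X Y) (g : arr X' Y') : arr (prd P X X') (prd P Y Y') :=
  pairing P (pr1 P X X' · f) (pr2 P X X' · g).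

Definition isWeakPullback (C : category) (A B' C' D : C)
    (f : arr A B') (g : arr A C') (h : arr B' D) (k : arr C' D) : Prop :=
  f · h = g · k /\
  forall (T : C) (b : arr T B') (c : arr T C'), b · h = c · k ->
    exists t : arr T A, t · f = b /\ t · g = c.

Definition hasWeakPullbacks (C : category) : Prop :=
  forall (B' C' D : C) (h : arr B' D) (k : arr C' D),
    exists (A : C) (f : arr A B') (g : arr A C'), isWeakPullback f g h k.

Record span (C : category) (X Y : C) := Span {
  apex : C;
  legl : arr apex X;
  legr : arr apex Y
}.

Definition spanLe (C : category) (X Y : C) (s t : span X Y) : Prop :=
  exists a : arr (apex s) (apex t), a · legl t = legl s /\ a · legr t = legr s.

Definition spanEqv (C : category) (X Y : C) (s t : span X Y) : Prop :=
  spanLe s t /\ spanLe t s.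

(* Equality of [spanClass] is equality of ∼-classes, by propositional and
   functional extensionality. *)
Record spanClass (C : category) (X Y : C) := SpanClass {
  members :> span X Y -> Prop;
  members_class : exists s, forall t, members t <-> spanEqv s t
}.

(* The choice of representatives does not matter, by transitivity. *)
Definition classLe (C : category) (X Y : C) (S T : spanClass X Y) : Prop :=
  exists s t, S s /\ T t /\ spanLe s t.

Lemma spanLe_refl (C : category) (X Y : C) (s : span X Y) : spanLe s s.
Proof. by exists (ida _); rewrite !cmp1a. Qed.

Lemma spanLe_trans (C : category) (X Y : C) (s t u : span X Y) :
  spanLe s t -> spanLe t u -> spanLe s u.
Proof.
move=> [a [a1 a2]] [b [b1 b2]]; exists (a · b).
by rewrite -!cmpA b1 b2.
Qed.

Lemma spanEqv_refl (C : category) (X Y : C) (s : span X Y) : spanEqv s s.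
Proof. split; exact: spanLe_refl. Qed.

Lemma spanEqv_sym (C : category) (X Y : C) (s t : span X Y) :
  spanEqv s t -> spanEqv t s.
Proof. by case. Qed.

Lemma spanEqv_trans (C : category) (X Y : C) (s t u : span X Y) :
  spanEqv s t -> spanEqv t u -> spanEqv s u.
Proof.
by move=> [st ts] [tu ut]; split; [exact: spanLe_trans tu | exact: spanLe_trans ts].
Qed.

Definition classOf (C : category) (X Y : C) (s : span X Y) : spanClass X Y :=
  SpanClass (ex_intro _ s (fun t => conj (fun h : spanEqv s t => h) (fun h => h))).

Definition isSpanComp (C : category) (X Y Z : C)
    (s : span X Y) (t : span Y Z) (u : span X Z) : Prop :=
  exists (p : arr (apex u) (apex s)) (q : arr (apex u) (apex t)),
    isWeakPullback p q (legr s) (legl t) /\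
    legl u = p · legl s /\ legr u = q · legr t.

Lemma isSpanComp_mono (C : category) (X Y Z : C) (s s' : span X Y)
    (t t' : span Y Z) (u u' : span X Z) :
  isSpanComp s t u -> isSpanComp s' t' u' ->
  spanLe s s' -> spanLe t t' -> spanLe u u'.
Proof.
move=> [p [q [[sq _] [ul ur]]]] [p' [q' [[_ wp] [ul' ur']]]].
move=> [a [a1 a2]] [b [b1 b2]].
have [|r [r1 r2]] := wp _ (p · a) (q · b); first by rewrite -!cmpA a2 b1.
exists r; rewrite ul ur ul' ur' !cmpA r1 r2; split.
  by rewrite -cmpA a1.
by rewrite -cmpA b2.
Qed.

Definition classCompMembers (C : category) (X Y Z : C)
    (S : spanClass X Y) (T : spanClass Y Z) (u : span X Z) : Prop :=
  exists s t v, S s /\ T t /\ isSpanComp s t v /\ spanEqv v u.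

Lemma classComp_subproof (C : category) (wp : hasWeakPullbacks C) (X Y Z : C)
    (S : spanClass X Y) (T : spanClass Y Z) :
  exists w, forall u, classCompMembers S T u <-> spanEqv w u.
Proof.
have [s0 hs] := members_class S; have [t0 ht] := members_class T.
have [P [p [q pq]]] := wp _ _ _ (legr s0) (legl t0).
pose w := Span (p · legl s0) (q · legr t0).
have wc : isSpanComp s0 t0 w by exists p, q.
exists w => u; split.
  move=> [s [t [v [/hs [ss1 ss2] [/ht [tt1 tt2] [vc vu]]]]]].
  apply: spanEqv_trans vu; split.
    exact: isSpanComp_mono wc vc ss1 tt1.
  exact: isSpanComp_mono vc wc ss2 tt2.
move=> wu; exists s0, t0, w; split; first by apply/hs; exact: spanEqv_refl.
by split; first by apply/ht; exact: spanEqv_refl.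
Qed.

Definition classComp (C : category) (wp : hasWeakPullbacks C) (X Y Z : C)
    (S : spanClass X Y) (T : spanClass Y Z) : spanClass X Z :=
  SpanClass (classComp_subproof wp S T).

Definition spanTens (C : category) (P : finProducts C) (X Y X' Y' : C)
    (s : span X Y) (t : span X' Y') : span (prd P X X') (prd P Y Y') :=
  Span (prdm P (legl s) (legl t)) (prdm P (legr s) (legr t)).

Lemma pairing_comp (C : category) (P : finProducts C) (S T X Y : C)
    (h : arr S T) (f : arr T X) (g : arr T Y) :
  h · pairing P f g = pairing P (h · f) (h · g).
Proof. by rewrite -[LHS]pairing_uniq -!cmpA pairing1 pairing2. Qed.

Lemma prdm_comp (C : category) (P : finProducts C) (X Y Z X' Y' Z' : C)
    (f : arr X Y) (g : arr Y Z) (f' : arr X' Y') (g' : arr Y' Z') :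
  prdm P f f' · prdm P g g' = prdm P (f · g) (f' · g').
Proof. by rewrite /prdm pairing_comp !cmpA pairing1 pairing2. Qed.

Lemma spanTens_mono (C : category) (P : finProducts C) (X Y X' Y' : C)
    (s s' : span X Y) (t t' : span X' Y') :
  spanLe s s' -> spanLe t t' -> spanLe (spanTens P s t) (spanTens P s' t').
Proof.
move=> [a [a1 a2]] [b [b1 b2]]; exists (prdm P a b).
by rewrite /= !prdm_comp a1 a2 b1 b2.
Qed.

Definition classTensMembers (C : category) (P : finProducts C) (X Y X' Y' : C)
    (S : spanClass X Y) (T : spanClass X' Y')
    (u : span (prd P X X') (prd P Y Y')) : Prop :=
  exists s t, S s /\ T t /\ spanEqv (spanTens P s t) u.

Lemma classTens_subproof (C : category) (P : finProducts C) (X Y X' Y' : C)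
    (S : spanClass X Y) (T : spanClass X' Y') :
  exists w, forall u, classTensMembers (P := P) S T u <-> spanEqv w u.
Proof.
have [s0 hs] := members_class S; have [t0 ht] := members_class T.
exists (spanTens P s0 t0) => u; split.
  move=> [s [t [/hs [ss1 ss2] [/ht [tt1 tt2] vu]]]].
  by apply: spanEqv_trans vu; split; exact: spanTens_mono.
move=> wu; exists s0, t0; split; first by apply/hs; exact: spanEqv_refl.
by split; first by apply/ht; exact: spanEqv_refl.
Qed.

Definition classTens (C : category) (P : finProducts C) (X Y X' Y' : C)
    (S : spanClass X Y) (T : spanClass X' Y') :
    spanClass (prd P X X') (prd P Y Y') :=
  SpanClass (classTens_subproof P S T).

Definition graphClass (C : category) (X Y : C) (f : arr X Y) : spanClass X Y :=
  classOf (Span (ida X) f).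

Definition cographClass (C : category) (X Y : C) (f : arr X Y) :
    spanClass Y X :=
  classOf (Span f (ida X)).

Definition SpanEq (C : category) (P : finProducts C)
    (wp : hasWeakPullbacks C) : cbData :=
  @CbData C (@spanClass C) (@classLe C)
    (fun X => graphClass (ida X))
    (@classComp C wp)
    (prd P) (term P) (@classTens C P)
    (fun X Y => graphClass (pairing P (pr2 P X Y) (pr1 P X Y)))
    (fun X => graphClass (pairing P (ida X) (ida X)))
    (fun X => graphClass (bang P X))
    (fun X => cographClass (pairing P (ida X) (ida X)))
    (fun X => cographClass (bang P X)).

Section CastLemmas.

Variable B : cbData.

Lemma castm_id (X Y : B) (e : X = X) (e' : Y = Y) (f : hom X Y) :
  castm e e' f = f.
Proof. by rewrite (proof_irrelevance _ e eq_refl) (proof_irrelevance _ e' eq_refl). Qed.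

Lemma castm_castm (X X' X'' Y Y' Y'' : B) (e : X = X') (e' : X' = X'')
    (d : Y = Y') (d' : Y' = Y'') (f : hom X Y) :
  castm e' d' (castm e d f) = castm (eq_trans e e') (eq_trans d d') f.
Proof. by destruct e', d'. Qed.

Lemma castm_irr (X X' Y Y' : B) (e e2 : X = X') (d d2 : Y = Y') (f : hom X Y) :
  castm e d f = castm e2 d2 f.
Proof. by rewrite (proof_irrelevance _ e e2) (proof_irrelevance _ d d2). Qed.

Lemma castm_comp (X X' Y Y' Z Z' : B) (e : X = X') (d : Y = Y') (c : Z = Z')
    (f : hom X Y) (g : hom Y Z) :
  castm e d f ;; castm d c g = castm e c (f ;; g).
Proof. by destruct e, d, c. Qed.

Lemma castm_tens (X1 X1' Y1 Y1' X2 X2' Y2 Y2' : B) (e1 : X1 = X1')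
    (d1 : Y1 = Y1') (e2 : X2 = X2') (d2 : Y2 = Y2')
    (f : hom X1 Y1) (g : hom X2 Y2) :
  castm e1 d1 f ⊠ castm e2 d2 g =
    castm (f_equal2 tens e1 e2) (f_equal2 tens d1 d2) (f ⊠ g).
Proof. by destruct e1, d1, e2, d2; rewrite !castm_id. Qed.

Lemma castm_idm (X X' : B) (e e' : X = X') : castm e e' (idm X) = idm X'.
Proof. by rewrite (proof_irrelevance _ e' e); destruct e. Qed.

Lemma comp_castr (X Y Z Z' : B) (e : Y = Y) (c : Z = Z') (f : hom X Y)
    (g : hom Y Z) :
  f ;; castm e c g = castm eq_refl c (f ;; g).
Proof. by destruct c; rewrite castm_id. Qed.

Lemma is_map_castm (X X' Y Y' : B) (e : X = X') (d : Y = Y') (f : hom X Y) :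
  is_map f -> is_map (castm e d f).
Proof. by destruct e, d. Qed.

End CastLemmas.

Section Maps.

Variable B : cartBicat.

Let cB : isCartBicat B := cb_axioms B.
Let sB : isStrictSMPos B := cB.

Lemma adjoint_is_map (X Y : B) (f : hom X Y) (g : hom Y X) :
  idm X ≼ f ;; g -> g ;; f ≼ idm Y -> is_map f.
Proof.
move=> fg gf; split; rewrite ?/single_valued ?/total.
  rewrite -[copy X](comp1m sB).
  apply: (hle_trans sB (g := f ;; (copy Y ;; (g ⊠ g)) ;; (f ⊠ f))).
    apply: (comp_mono sB); last exact: (hle_refl sB).
    apply: (hle_trans sB (g := f ;; g ;; copy X)).
      by apply: (comp_mono sB) => //; exact: (hle_refl sB).
    rewrite -(compA sB); apply: (comp_mono sB); first exact: (hle_refl sB).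
    exact: (copy_lax cB).
  rewrite -!(compA sB) -(tensm_comp sB).
  apply: (comp_mono sB); first exact: (hle_refl sB).
  rewrite -[X in _ ≼ X](compm1 sB) -(tensm_id sB).
  apply: (comp_mono sB); first exact: (hle_refl sB).
  exact: (tensm_mono sB).
rewrite -[discard X](comp1m sB).
apply: (hle_trans sB (g := f ;; g ;; discard X)).
  by apply: (comp_mono sB) => //; exact: (hle_refl sB).
rewrite -(compA sB); apply: (comp_mono sB); first exact: (hle_refl sB).
exact: (discard_lax cB).
Qed.

Lemma is_map_id (X : B) : is_map (idm X).
Proof. apply: (@adjoint_is_map _ _ _ (idm X)); rewrite (comp1m sB); exact: (hle_refl sB). Qed.

Lemma is_map_copy (X : B) : is_map (copy X).
Proof. exact: adjoint_is_map (copy_unit cB X) (copy_counit cB X). Qed.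

Lemma is_map_discard (X : B) : is_map (discard X).
Proof. exact: adjoint_is_map (discard_unit cB X) (discard_counit cB X). Qed.

Lemma is_map_sym (X Y : B) : is_map (sym X Y).
Proof. by apply: (@adjoint_is_map _ _ _ (sym Y X)); rewrite (symK sB); exact: (hle_refl sB). Qed.

Lemma is_map_comp (X Y Z : B) (f : hom X Y) (g : hom Y Z) :
  is_map f -> is_map g -> is_map (f ;; g).
Proof.
move=> [sf tf] [sg tg]; split; rewrite ?/single_valued ?/total.
  rewrite (tensm_comp sB) (compA sB).
  apply: (hle_trans sB (g := f ;; copy Y ;; (g ⊠ g))).
    by apply: (comp_mono sB) => //; exact: (hle_refl sB).
  rewrite -!(compA sB); apply: (comp_mono sB) => //; exact: (hle_refl sB).
apply: (hle_trans sB tf).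
rewrite -(compA sB); apply: (comp_mono sB) => //; exact: (hle_refl sB).
Qed.

Lemma map_copy (X Y : B) (f : hom X Y) :
  is_map f -> copy X ;; (f ⊠ f) = f ;; copy Y.
Proof. by case=> sf _; apply: (hle_anti sB) => //; exact: (copy_lax cB). Qed.

Lemma map_discard (X Y : B) (f : hom X Y) :
  is_map f -> f ;; discard Y = discard X.
Proof. by case=> _ tf; apply: (hle_anti sB) => //; exact: (discard_lax cB). Qed.

Lemma swap_mid_nat (X X' Z Z' W W' Y Y' : B)
    (f : hom X X') (g : hom Z Z') (h : hom W W') (k : hom Y Y') :
  ((f ⊠ g) ⊠ (h ⊠ k)) ;; swap_mid sB X' Z' W' Y' =
  swap_mid sB X Z W Y ;; ((f ⊠ h) ⊠ (g ⊠ k)).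
Proof.
have cast4 (P P' Q Q' R R' S S' : B) (a : hom P P') (b : hom Q Q')
    (c : hom R R') (d : hom S S') :
  (a ⊠ b) ⊠ (c ⊠ d) = castm (eq_sym (tens_mid sB P Q R S))
     (eq_sym (tens_mid sB P' Q' R' S')) (a ⊠ ((b ⊠ c) ⊠ d)).
  rewrite -(tensmA sB b c d) -[a]/(castm eq_refl eq_refl a) castm_tens.
  rewrite castm_castm /= -(tensmA sB a b (c ⊠ d)); exact: castm_irr.
rewrite /swap_mid !cast4 !castm_comp -!(tensm_comp sB).
by rewrite !(comp1m sB) !(compm1 sB) (sym_nat sB).
Qed.

Lemma is_map_tens (X Y X' Y' : B) (f : hom X Y) (g : hom X' Y') :
  is_map f -> is_map g -> is_map (f ⊠ g).
Proof.
move=> mf mg; split; rewrite ?/single_valued ?/total.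
  rewrite !(copy_tens cB) -(compA sB) -swap_mid_nat !(compA sB) -!(tensm_comp sB).
  rewrite !map_copy //; exact: (hle_refl sB).
rewrite !(discard_tens cB) comp_castr -(tensm_comp sB) !map_discard //.
exact: (hle_refl sB).
Qed.

Lemma sym_unit : sym unit unit = idm (unit ⊗ unit : B).
Proof.
have d : discard (unit ⊗ unit : B) = castm eq_refl (tens1 sB unit) (idm (unit ⊗ unit)).
  rewrite (discard_tens cB) (discard1 cB) (tensm_id sB); exact: castm_irr.
have := map_discard (is_map_sym unit unit).
rewrite d comp_castr (compm1 sB).
have inj (U V V' : B) (e : V = V') (a b : hom U V) :
  castm eq_refl e a = castm eq_refl e b -> a = b by destruct e.
exact: inj.
Qed.

Definition mapArr (X Y : B) : Type := { f : hom X Y | is_map f }.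

Lemma mapArr_eq (X Y : B) (f g : mapArr X Y) : proj1_sig f = proj1_sig g -> f = g.
Proof. by case: f g => [f mf] [g mg] /= e; subst g; rewrite (proof_irrelevance _ mf mg). Qed.

Definition mapId (X : B) : mapArr X X := exist _ (idm X) (is_map_id X).

Definition mapCmp (X Y Z : B) (f : mapArr X Y) (g : mapArr Y Z) : mapArr X Z :=
  exist _ (proj1_sig f ;; proj1_sig g) (is_map_comp (proj2_sig f) (proj2_sig g)).

Definition MapCat : category.
Proof.
refine (@Category B mapArr mapId mapCmp _ _ _).
- by move=> X Y f; apply: mapArr_eq; exact: (comp1m sB).
- by move=> X Y f; apply: mapArr_eq; exact: (compm1 sB).
- by move=> X Y Z W f g h; apply: mapArr_eq; exact: (compA sB).
Defined.

(* X ⊗ Y -> X ⊗ I = X and X ⊗ Y -> I ⊗ Y = Y *)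
Definition projl (X Y : B) : hom (X ⊗ Y) X :=
  castm eq_refl (tensX1 sB X) (idm X ⊠ discard Y).
Definition projr (X Y : B) : hom (X ⊗ Y) Y :=
  castm eq_refl (tens1 sB Y) (discard X ⊠ idm Y).

Lemma is_map_projl (X Y : B) : is_map (projl X Y).
Proof. by apply: is_map_castm; apply: is_map_tens; [exact: is_map_id | exact: is_map_discard]. Qed.

Lemma is_map_projr (X Y : B) : is_map (projr X Y).
Proof. by apply: is_map_castm; apply: is_map_tens; [exact: is_map_discard | exact: is_map_id]. Qed.

Lemma copy_projl (T X Y : B) (f : hom T X) (g : hom T Y) : is_map g ->
  copy T ;; (f ⊠ g) ;; projl X Y = f.
Proof.
move=> mg; rewrite /projl comp_castr -(compA sB) -(tensm_comp sB) (compm1 sB).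
rewrite map_discard // -{1}[f](comp1m sB) -{1}[discard T](compm1 sB).
rewrite (tensm_comp sB) (compA sB).
rewrite -(castm_comp eq_refl (tensX1 sB T)) (copyX1 cB).
by rewrite (tensmX1 sB) (comp1m sB).
Qed.

Lemma copy_projr (T X Y : B) (f : hom T X) (g : hom T Y) : is_map f ->
  copy T ;; (f ⊠ g) ;; projr X Y = g.
Proof.
move=> mf; rewrite /projr comp_castr -(compA sB) -(tensm_comp sB) (compm1 sB).
rewrite map_discard // -{1}[g](comp1m sB) -{1}[discard T](compm1 sB).
rewrite (tensm_comp sB) (compA sB).
rewrite -(castm_comp eq_refl (tens1 sB T)) (copy1 cB).
by rewrite (tensm1 sB) (comp1m sB).
Qed.

Lemma copy_proj (X Y : B) :
  copy (X ⊗ Y) ;; (projl X Y ⊠ projr X Y) = idm (X ⊗ Y).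
Proof.
rewrite (copy_tens cB) /projl /projr castm_tens /= comp_castr -(compA sB).
rewrite -swap_mid_nat (compA sB) -(tensm_comp sB).
have -> : swap_mid sB X unit unit Y = idm _.
  by rewrite /swap_mid sym_unit !(tensm_id sB) castm_idm.
rewrite (compm1 sB).
have -> : copy X ;; (idm X ⊠ discard X) = castm eq_refl (eq_sym (tensX1 sB X)) (idm X).
  by rewrite -[in RHS](copyX1 cB) castm_castm castm_id.
have -> : copy Y ;; (discard Y ⊠ idm Y) = castm eq_refl (eq_sym (tens1 sB Y)) (idm Y).
  by rewrite -[in RHS](copy1 cB) castm_castm castm_id.
by rewrite castm_tens (tensm_id sB) castm_castm castm_id.
Qed.

Definition MapProducts : finProducts MapCat.
Proof.
refine (@FinProducts MapCat (fun X Y : B => X ⊗ Y)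
  (fun X Y => exist _ (projl X Y) (is_map_projl X Y))
  (fun X Y => exist _ (projr X Y) (is_map_projr X Y))
  (fun T X Y f g => exist _ (copy T ;; (proj1_sig f ⊠ proj1_sig g))
     (is_map_comp (is_map_copy T) (is_map_tens (proj2_sig f) (proj2_sig g))))
  _ _ _
  unit (fun X => exist _ (discard X) (is_map_discard X)) _).
- by move=> T X Y f [g mg]; apply: mapArr_eq; exact: copy_projl.
- by move=> T X Y [f mf] g; apply: mapArr_eq; exact: copy_projr.
- move=> T X Y [h mh]; apply: mapArr_eq => /=.
  by rewrite (tensm_comp sB) (compA sB) map_copy // -(compA sB) copy_proj (compm1 sB).
- move=> X [f mf]; apply: mapArr_eq => /=.
  by rewrite -(map_discard mf) (discard1 cB) (compm1 sB).
Defined.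

End Maps.

(* Main.v *)
(* A span with legs l, r in Map(B) denotes the morphism l^op ; r. By the snake
   identities, morphisms X → Y correspond to morphisms X ⊗ Y → I, and l^op ; r
   corresponds to <l,r>^op ; ε. Hence enough maps means that every morphism is
   denoted by a span. If l^op ; r ≤ l'^op ; r', then <l,r> ; <l',r'>^op is total,
   and a map below it (axiom of choice) is a morphism from the first span to the
   second: so under choice the order on spans is the order of B, weak pullbacks
   are the squares with p^op ; q = h ; k^op, and spans up to equivalence form a
   copy of B. Conversely, a total span has a split left leg, so choice holds in
   every category of spans, and it is transported along isomorphisms. *)
From Stdlib Require Import ssreflect ssrfun.
From Stdlib Require Import ProofIrrelevance FunctionalExtensionality.
From Stdlib Require Import PropExtensionality IndefiniteDescription.
Require Import Defs.

Set Implicit Arguments.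
Unset Strict Implicit.
Unset Printing Implicit Defensive.

(** * Transport along object equalities, and adjoint pairs *)

Lemma hle_castm (B : cbData) (X X' Y Y' : B) (e : X = X') (d : Y = Y')
    (f g : hom X Y) :
  f ≼ g -> castm e d f ≼ castm e d g.
Proof. by destruct e, d. Qed.

Lemma castm_comp_irr (B : cbData) (X X' Y Y' Z Z' : B) (e : X = X')
    (d d' : Y = Y') (c : Z = Z') (f : hom X Y) (g : hom Y Z) :
  castm e d f ;; castm d' c g = castm e c (f ;; g).
Proof. by rewrite (proof_irrelevance _ d' d) castm_comp. Qed.

(** The middle objects [Y1] and [Y2] may differ: in [contract_exchange] the two sides pass through
    different bracketings of one tensor product. *)
Lemma castm_comp_congr (B : cbData) (X X' Y Y1 Y2 V Z Z' : B) (e1 e2 : X = X')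
    (d1 : Y = Y1) (d2 : Y = Y2) (b1 : V = Y1) (b2 : V = Y2) (c1 c2 : Z = Z')
    (f : hom X Y) (g : hom V Z) :
  castm e1 d1 f ;; castm b1 c1 g = castm e2 d2 f ;; castm b2 c2 g.
Proof.
rewrite (proof_irrelevance _ e2 e1) (proof_irrelevance _ c2 c1).
destruct b1, e1, c1, d2.
by rewrite (proof_irrelevance _ d1 (eq_sym b2)); destruct b2.
Qed.

Definition adjoint (B : cbData) (X Y : B) (f : hom X Y) (g : hom Y X) : Prop :=
  idm X ≼ f ;; g /\ g ;; f ≼ idm Y.

Lemma adjoint_castm (B : cbData) (X X' Y Y' : B) (e : X = X') (d : Y = Y')
    (f : hom X Y) (g : hom Y X) :
  adjoint f g -> adjoint (castm e d f) (castm d e g).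
Proof. by destruct e, d. Qed.

(** * Calculus of adjoint pairs in a cartesian bicategory *)

Section CartesianBicategory.

Variable B : cartBicat.

Let cB : isCartBicat B := cb_axioms B.
Let sB : isStrictSMPos B := cB.

Lemma comp_monol (X Y Z : B) (f f' : hom X Y) (g : hom Y Z) :
  f ≼ f' -> f ;; g ≼ f' ;; g.
Proof. by move=> ff'; apply: (comp_mono sB) => //; exact: (hle_refl sB). Qed.

Lemma comp_monor (X Y Z : B) (f : hom X Y) (g g' : hom Y Z) :
  g ≼ g' -> f ;; g ≼ f ;; g'.
Proof. by move=> gg'; apply: (comp_mono sB) => //; exact: (hle_refl sB). Qed.

Lemma tensm_split (X Y X' Y' : B) (f : hom X Y) (g : hom X' Y') :
  f ⊠ g = (f ⊠ idm X') ;; (idm Y ⊠ g).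
Proof. by rewrite -(tensm_comp sB) (comp1m sB) (compm1 sB). Qed.

Lemma tensm_split' (X Y X' Y' : B) (f : hom X Y) (g : hom X' Y') :
  f ⊠ g = (idm X ⊠ g) ;; (f ⊠ idm Y').
Proof. by rewrite -(tensm_comp sB) (comp1m sB) (compm1 sB). Qed.

Lemma tensm_compl (X Y Z W : B) (f : hom X Y) (g : hom Y Z) :
  (f ;; g) ⊠ idm W = (f ⊠ idm W) ;; (g ⊠ idm W).
Proof. by rewrite -(tensm_comp sB) (comp1m sB). Qed.

Lemma tensm_compr (X Y Z W : B) (f : hom X Y) (g : hom Y Z) :
  idm W ⊠ (f ;; g) = (idm W ⊠ f) ;; (idm W ⊠ g).
Proof. by rewrite -(tensm_comp sB) (comp1m sB). Qed.

(** The chain is $g' \le g';f;g \le g';f';g \le g$. *)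
Lemma adjoint_le (X Y : B) (f f' : hom X Y) (g g' : hom Y X) :
  adjoint f g -> adjoint f' g' -> f ≼ f' -> g' ≼ g.
Proof.
move=> [fg _] [_ gf'] ff'; rewrite -[X in X ≼ _](compm1 sB).
apply: (hle_trans sB); first exact: comp_monor fg.
rewrite (compA sB) -[X in _ ≼ X](comp1m sB); apply: comp_monol.
by apply: (hle_trans sB) gf'; exact: comp_monor.
Qed.

Lemma adjoint_uniqr (X Y : B) (f : hom X Y) (g g' : hom Y X) :
  adjoint f g -> adjoint f g' -> g = g'.
Proof.
move=> a a'; apply: (hle_anti sB).
  apply: adjoint_le a' a _; exact: (hle_refl sB).
apply: adjoint_le a a' _; exact: (hle_refl sB).
Qed.

Lemma adjoint_id (X : B) : adjoint (idm X) (idm X).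
Proof. by split; rewrite (comp1m sB); exact: (hle_refl sB). Qed.

Lemma adjoint_comp (X Y Z : B) (f : hom X Y) (f' : hom Y X) (g : hom Y Z)
    (g' : hom Z Y) :
  adjoint f f' -> adjoint g g' -> adjoint (f ;; g) (g' ;; f').
Proof.
move=> [f1 f2] [g1 g2]; split.
  apply: (hle_trans sB f1); rewrite -!(compA sB) [g ;; _](compA sB).
  by apply: comp_monor; rewrite -[X in X ≼ _](comp1m sB); exact: comp_monol.
apply: (hle_trans sB) g2; rewrite -!(compA sB) [f' ;; _](compA sB).
by apply: comp_monor; rewrite -[X in _ ≼ X](comp1m sB); exact: comp_monol.
Qed.

Lemma adjoint_tens (X Y X' Y' : B) (f : hom X Y) (f' : hom Y X)
    (g : hom X' Y') (g' : hom Y' X') :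
  adjoint f f' -> adjoint g g' -> adjoint (f ⊠ g) (f' ⊠ g').
Proof.
by move=> [f1 f2] [g1 g2]; split; rewrite -(tensm_comp sB) -(tensm_id sB);
  apply: (tensm_mono sB).
Qed.

Lemma adjoint_copy (X : B) : adjoint (copy X) (cocopy X).
Proof. by split; [exact: (copy_unit cB) | exact: (copy_counit cB)]. Qed.

Lemma adjoint_discard (X : B) : adjoint (discard X) (codiscard X).
Proof. by split; [exact: (discard_unit cB) | exact: (discard_counit cB)]. Qed.

Lemma adjoint_sym (X Y : B) : adjoint (sym X Y) (sym Y X).
Proof. by split; rewrite (symK sB); exact: (hle_refl sB). Qed.

(** Mate of [discard_lax] under the adjunctions between [discard] and [codiscard]; [cocopy_lax] is
    obtained from [copy_lax] in the same way. *)
Lemma codiscard_lax (X Y : B) (R : hom X Y) : codiscard X ;; R ≼ codiscard Y.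
Proof.
rewrite -[X in X ≼ _](compm1 sB) -[X in _ ≼ X](comp1m sB).
apply: (hle_trans sB); first exact: comp_monor (discard_unit cB Y).
rewrite (compA sB); apply: comp_monol.
apply: (hle_trans sB) (discard_counit cB X); rewrite -(compA sB).
exact: comp_monor (discard_lax cB R).
Qed.

Lemma cocopy_lax (X Y : B) (R : hom X Y) : cocopy X ;; R ≼ (R ⊠ R) ;; cocopy Y.
Proof.
rewrite -[X in X ≼ _](compm1 sB).
apply: (hle_trans sB); first exact: comp_monor (copy_unit cB Y).
rewrite (compA sB); apply: comp_monol; rewrite -(compA sB).
apply: (hle_trans sB); first exact: comp_monor (copy_lax cB R).
rewrite (compA sB) -[X in _ ≼ X](comp1m sB).
exact: comp_monol (copy_counit cB X).
Qed.

(** Right adjoints are unique, so each comonoid law of [copy] and [discard] dualizes to a monoid law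
    of [cocopy] and [codiscard]; [codiscard_cocopy] is another instance. *)
Lemma cocopyC (X : B) : sym X X ;; cocopy X = cocopy X.
Proof.
apply: (adjoint_uniqr (f := copy X)); last exact: adjoint_copy.
rewrite -{1}(copyC cB); apply: adjoint_comp; [exact: adjoint_copy | exact: adjoint_sym].
Qed.

Lemma codiscard_cocopy (X : B) :
  castm (tensX1 sB X) eq_refl ((idm X ⊠ codiscard X) ;; cocopy X) = idm X.
Proof.
apply: (adjoint_uniqr (f := idm X)); last exact: adjoint_id.
rewrite -{1}(copyX1 cB X); apply: adjoint_castm; apply: adjoint_comp.
  exact: adjoint_copy.
by apply: adjoint_tens; [exact: adjoint_id | exact: adjoint_discard].
Qed.

(** * Self-duality of objects, with unit [cap] and counit [cup] *)

Definition cap (X : B) : hom unit (X ⊗ X) := codiscard X ;; copy X.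
Definition cup (X : B) : hom (X ⊗ X) unit := cocopy X ;; discard X.

Lemma cup_sym (X : B) : sym X X ;; cup X = cup X.
Proof. by rewrite /cup (compA sB) cocopyC. Qed.

(* W → W ⊗ A ⊗ C → C; [contract'] is its mirror image V → A ⊗ C ⊗ V → A. *)
Definition contract (W A C : B) (Q : hom unit (A ⊗ C)) (P : hom (W ⊗ A) unit) :
    hom W C :=
  castm (tensX1 sB W) eq_refl (idm W ⊠ Q)
  ;; castm (eq_sym (tensA sB W A C)) (tens1 sB C) (P ⊠ idm C).

Definition contract' (V A C : B) (Q : hom unit (A ⊗ C)) (P : hom (C ⊗ V) unit) :
    hom V A :=
  castm (tens1 sB V) eq_refl (Q ⊠ idm V)
  ;; castm (tensA sB A C V) (tensX1 sB A) (idm A ⊠ P).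

Lemma contract_mono (W A C : B) (Q Q' : hom unit (A ⊗ C))
    (P P' : hom (W ⊗ A) unit) :
  Q ≼ Q' -> P ≼ P' -> contract Q P ≼ contract Q' P'.
Proof.
move=> QQ' PP'; apply: (comp_mono sB); apply: hle_castm; apply: (tensm_mono sB) => //;
  exact: (hle_refl sB).
Qed.

Lemma tensmA_sym (X Y X' Y' X'' Y'' : B)
    (f : hom X Y) (g : hom X' Y') (h : hom X'' Y'') :
  castm (eq_sym (tensA sB X X' X'')) (eq_sym (tensA sB Y Y' Y'')) (f ⊠ g ⊠ h) =
  f ⊠ (g ⊠ h).
Proof. by rewrite -(tensmA sB) castm_castm castm_id. Qed.

Lemma contract_compl (W W' A C : B) (F : hom W' W) (Q : hom unit (A ⊗ C))
    (P : hom (W ⊗ A) unit) :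
  contract Q ((F ⊠ idm A) ;; P) = F ;; contract Q P.
Proof.
rewrite /contract tensm_compl.
rewrite -(castm_comp _ (eq_sym (tensA sB W A C))) tensmA_sym (tensm_id sB) (compA sB).
rewrite -[F ⊠ _]/(castm eq_refl eq_refl _) castm_comp -tensm_split' tensm_split.
by rewrite -(castm_comp _ (tensX1 sB W)) (tensmX1 sB) (compA sB).
Qed.

Lemma contract_compr (W A C D : B) (Q : hom unit (A ⊗ C))
    (P : hom (W ⊗ A) unit) (G : hom C D) :
  contract (Q ;; (idm A ⊠ G)) P = contract Q P ;; G.
Proof.
rewrite /contract tensm_compr.
rewrite -(castm_comp _ eq_refl) -!(compA sB); congr (_ ;; _).
rewrite /= -tensmA_sym castm_comp (tensm_id sB) -tensm_split' tensm_split.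
by rewrite -(castm_comp _ (tens1 sB C)) (tensm1 sB).
Qed.

Lemma contract_slide (W A A' C : B) (Q : hom unit (A ⊗ C)) (G : hom A A')
    (P : hom (W ⊗ A') unit) :
  contract (Q ;; (G ⊠ idm C)) P = contract Q ((idm W ⊠ G) ;; P).
Proof.
rewrite /contract tensm_compr.
rewrite -(castm_comp _ eq_refl) -!(compA sB); congr (_ ;; _).
by rewrite /= -tensmA_sym castm_comp -(tensm_comp sB) (compm1 sB).
Qed.

Lemma oppositeE (X Y : B) (R : hom X Y) :
  opposite R = contract (cap X) ((idm Y ⊠ R) ;; cup Y).
Proof.
rewrite /opposite /contract -/(cap X) -/(cup Y) -(compA sB); congr (_ ;; _).
rewrite tensm_compl -(castm_comp _ eq_refl).
congr (_ ;; _); rewrite -(tensmA sB) castm_castm; exact: castm_irr.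
Qed.

(** In the middle of the composite stands one side of the Frobenius law. Replacing it by
    [cocopy X ;; copy X] lets the unit law of [cocopy] and the counit law of [copy] cancel the two
    ends. *)
Lemma snake (X : B) : contract (cap X) (cup X) = idm X.
Proof.
rewrite /contract /cap /cup tensm_compr tensm_compl.
rewrite -(castm_comp _ eq_refl eq_refl) -(castm_comp _ eq_refl (tens1 sB X)).
rewrite -!(compA sB) (compA sB (castm eq_refl eq_refl _)).
have -> : castm eq_refl eq_refl (idm X ⊠ copy X) ;;
    castm (eq_sym (tensA sB X X X)) eq_refl (cocopy X ⊠ idm X) =
    castm eq_refl (tensA sB X X X) (idm X ⊠ copy X) ;; (cocopy X ⊠ idm X).
  by case: _ / (tensA sB X X X) (cocopy X ⊠ idm X).
rewrite -(frobenius cB) -(compA sB) (compA sB) -[cocopy X]/(castm eq_refl eq_refl _).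
rewrite castm_comp codiscard_cocopy (comp1m sB).
by rewrite -[copy X]/(castm eq_refl eq_refl _) castm_comp (copy1 cB).
Qed.

(** Both sides insert [Q] between [W] and [V] and then close with [P ⊠ P']; by interchange, the
    order in which [P] and [P'] are applied is irrelevant. *)
Lemma contract_exchange (W V A C : B) (Q : hom unit (A ⊗ C))
    (P : hom (W ⊗ A) unit) (P' : hom (C ⊗ V) unit) :
  (contract Q P ⊠ idm V) ;; P' = (idm W ⊠ contract' Q P') ;; P.
Proof.
rewrite /contract /contract' tensm_compl tensm_compr -!(compA sB).
have -> : (castm (eq_sym (tensA sB W A C)) (tens1 sB C) (P ⊠ idm C) ⊠ idm V) ;; P' =
    castm (eq_trans (tensA sB (W ⊗ A) C V)
             (f_equal2 tens (eq_sym (tensA sB W A C)) eq_refl)) (tens1 sB unit)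
      (P ⊠ P').
  rewrite -{1}(tensm1 sB P') -[idm V]/(castm eq_refl eq_refl _) castm_tens.
  rewrite -(tensmA sB) castm_castm castm_comp_irr (tensm_id sB) -tensm_split.
  exact: castm_irr.
have -> : (idm W ⊠ castm (tensA sB A C V) (tensX1 sB A) (idm A ⊠ P')) ;; P =
    castm (eq_trans (eq_sym (tensA sB W A (C ⊗ V)))
             (f_equal2 tens eq_refl (tensA sB A C V))) (tens1 sB unit)
      (P ⊠ P').
  rewrite -{1}(tensmX1 sB P) -[idm W]/(castm eq_refl eq_refl _) castm_tens.
  rewrite -tensmA_sym castm_castm castm_comp_irr (tensm_id sB) -tensm_split'.
  exact: castm_irr.
rewrite -[idm V]/(castm eq_refl eq_refl _) -[idm W in RHS]/(castm eq_refl eq_refl _).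
rewrite !castm_tens -(tensmA sB) !castm_castm; exact: castm_comp_congr.
Qed.

(* The Frobenius law yields only [snake]; the other snake s satisfies
   (id ⊗ s) ; cup = cup, and cup is symmetric and nondegenerate by [snake]. *)
Lemma snake' (X : B) : contract' (cap X) (cup X) = idm X.
Proof.
have := contract_exchange (cap X) (cup X) (cup X).
rewrite snake (tensm_id sB) (comp1m sB) => e.
rewrite -[LHS](compm1 sB) -{1}(snake X) -contract_compl -{2}cup_sym (compA sB).
by rewrite (sym_nat sB) -(compA sB) -e cup_sym snake.
Qed.

(** Together with [contract_bend], this gives the bijection between morphisms [W] → [X] and
    morphisms [W ⊗ X] → [unit]. *)
Lemma bend_contract (W X : B) (P : hom (W ⊗ X) unit) :
  (contract (cap X) P ⊠ idm X) ;; cup X = P.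
Proof. by rewrite contract_exchange snake' (tensm_id sB) (comp1m sB). Qed.

Lemma contract_bend (X Y : B) (R : hom X Y) :
  contract (cap Y) ((R ⊠ idm Y) ;; cup Y) = R.
Proof. by rewrite contract_compl snake (compm1 sB). Qed.

Lemma opposite_cup (X Y : B) (R : hom X Y) :
  (opposite R ⊠ idm X) ;; cup X = (idm Y ⊠ R) ;; cup Y.
Proof. by rewrite oppositeE bend_contract. Qed.

Lemma opposite_cup' (X Y : B) (R : hom X Y) :
  (idm X ⊠ opposite R) ;; cup X = (R ⊠ idm Y) ;; cup Y.
Proof.
rewrite -(cup_sym X) (compA sB) (sym_nat sB) -(compA sB) opposite_cup.
by rewrite (compA sB) -(sym_nat sB) -(compA sB) cup_sym.
Qed.

(** * Opposites of maps as right adjoints *)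

(** Writing identities as snakes reduces the unit to [cup X] ≤ [(f ⊠ f) ;; cup Y] and the counit to
    [cap X ;; (f ⊠ f)] ≤ [cap Y]. The first combines totality with [cocopy_lax], the second
    single-valuedness with [codiscard_lax]. *)
Lemma adjoint_opposite (X Y : B) (f : hom X Y) :
  is_map f -> adjoint f (opposite f).
Proof.
move=> mf; have [sf tf] := mf; split.
  rewrite oppositeE -contract_compl (compA sB) -tensm_split -(snake X).
  apply: contract_mono; first exact: (hle_refl sB).
  rewrite /cup -(map_discard mf) !(compA sB); apply: comp_monol; exact: cocopy_lax.
rewrite oppositeE -contract_slide -contract_compr -(compA sB) -tensm_split -(snake Y).
apply: contract_mono; last exact: (hle_refl sB).
rewrite /cap -(compA sB) (map_copy mf) (compA sB); apply: comp_monol.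
exact: codiscard_lax.
Qed.

Lemma opposite_eq (X Y : B) (f : hom X Y) (g : hom Y X) :
  is_map f -> adjoint f g -> opposite f = g.
Proof. by move=> mf; apply: adjoint_uniqr; exact: adjoint_opposite. Qed.

Lemma opposite_comp (X Y Z : B) (f : hom X Y) (g : hom Y Z) :
  is_map f -> is_map g -> opposite (f ;; g) = opposite g ;; opposite f.
Proof.
move=> mf mg; apply: opposite_eq; first exact: is_map_comp.
by apply: adjoint_comp; exact: adjoint_opposite.
Qed.

Lemma opposite_tens (X Y X' Y' : B) (f : hom X Y) (g : hom X' Y') :
  is_map f -> is_map g -> opposite (f ⊠ g) = opposite f ⊠ opposite g.
Proof.
move=> mf mg; apply: opposite_eq; first exact: is_map_tens.
by apply: adjoint_tens; exact: adjoint_opposite.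
Qed.

Lemma opposite_id (X : B) : opposite (idm X) = idm X.
Proof. by apply: opposite_eq; [exact: is_map_id | exact: adjoint_id]. Qed.

Lemma opposite_copy (X : B) : opposite (copy X) = cocopy X.
Proof. by apply: opposite_eq; [exact: is_map_copy | exact: adjoint_copy]. Qed.

Lemma opposite_discard (X : B) : opposite (discard X) = codiscard X.
Proof. by apply: opposite_eq; [exact: is_map_discard | exact: adjoint_discard]. Qed.

(** Taking opposites is monotone, whence $g \le f;f^{op};g \le f;g^{op};g \le f$. *)
Lemma map_le_eq (X Y : B) (f g : hom X Y) : is_map f -> is_map g -> f ≼ g -> f = g.
Proof.
move=> mf mg fg; apply: (hle_anti sB) => //.
have [af ag] := (adjoint_opposite mf, adjoint_opposite mg).
have [ff _] := af; have [_ gg] := ag.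
rewrite -[X in X ≼ _](comp1m sB) -[X in _ ≼ X](compm1 sB).
apply: (hle_trans sB); first exact: comp_monol ff.
rewrite -(compA sB); apply: comp_monor.
apply: (hle_trans sB) gg; apply: comp_monol.
rewrite !oppositeE; apply: contract_mono; first exact: (hle_refl sB).
by apply: comp_monol; apply: (tensm_mono sB) => //; exact: (hle_refl sB).
Qed.

(** * Relations denoted by spans of maps *)

(** Sliding [r] across the cup turns it into [opposite r] on the other strand, and [cup A] is
    [cocopy A ;; discard A]. The right side has the shape provided by [enoughMaps]. *)
Lemma bend_rel (A X Y : B) (l : hom A X) (r : hom A Y) : is_map l -> is_map r ->
  ((opposite l ;; r) ⊠ idm Y) ;; cup Y = opposite (copy A ;; (l ⊠ r)) ;; discard A.
Proof.
move=> ml mr; rewrite tensm_compl -(compA sB) -opposite_cup' (compA sB) -tensm_split /cup.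
rewrite opposite_comp ?opposite_tens ?opposite_copy -?(compA sB) //.
  exact: is_map_copy.
exact: is_map_tens.
Qed.

Definition spanRel (X Y : MapCat B) (s : span X Y) : @hom B X Y :=
  opposite (proj1_sig (legl s)) ;; proj1_sig (legr s).

Lemma spanRel_mono (X Y : MapCat B) (s t : span X Y) :
  spanLe s t -> spanRel s ≼ spanRel t.
Proof.
case: s t => [A [l ml] [r mr]] [A' [l' ml'] [r' mr']] [[a ma] [/= al ar]].
rewrite /spanRel /=.
move: (f_equal (@proj1_sig _ _) al) (f_equal (@proj1_sig _ _) ar) => /= <- <-.
rewrite opposite_comp //; have [_] := adjoint_opposite ma.
move: (opposite a) (opposite l') => a' l'' aa.
rewrite -!(compA sB) (compA sB a'); apply: comp_monor.
by rewrite -[X in _ ≼ X](comp1m sB); exact: comp_monol.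
Qed.

Lemma spanRel_eqv (X Y : MapCat B) (s t : span X Y) :
  spanEqv s t -> spanRel s = spanRel t.
Proof. by case=> st ts; apply: (hle_anti sB); exact: spanRel_mono. Qed.

Lemma spanLe_rel (ac : axiomOfChoice B) (X Y : MapCat B) (s t : span X Y) :
  spanRel s ≼ spanRel t -> spanLe s t.
Proof.
case: s t => [A [l ml] [r mr]] [A' [l' ml'] [r' mr']]; rewrite /spanRel /= => le.
pose f := copy A ;; (l ⊠ r); pose f' := copy A' ;; (l' ⊠ r').
have mf : is_map f by apply: is_map_comp; [exact: is_map_copy | exact: is_map_tens].
have mf' : is_map f' by apply: is_map_comp; [exact: is_map_copy | exact: is_map_tens].
have [ff _] := adjoint_opposite mf; have [_ ff'] := adjoint_opposite mf'.
have [|a [ma af]] := ac _ _ (f ;; opposite f').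
  (* By [bend_rel], [opposite f ;; discard A] is the first relation bent and
     [opposite f' ;; discard A'] the second, so the hypothesis compares them; the unit of [f] then
     gives totality. *)
  rewrite /total -(compA sB) -bend_rel //.
  apply: (hle_trans sB (g := f ;; opposite f ;; discard A)).
    by rewrite -[X in X ≼ _](comp1m sB); exact: comp_monol.
  rewrite -(compA sB) -bend_rel //; apply: comp_monor; apply: comp_monol.
  by apply: (tensm_mono sB) => //; exact: (hle_refl sB).
(* Here $a;f' \le f;f'^{op};f' \le f$, and comparable maps are equal. Projecting recovers the two
   leg equations. *)
have e : a ;; f' = f.
  apply: map_le_eq => //; first exact: is_map_comp.
  apply: (hle_trans sB); first exact: comp_monol af.
  by rewrite -(compA sB) -[X in _ ≼ X](compm1 sB); exact: comp_monor.
exists (exist _ a ma); split; apply: mapArr_eq => /=.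
  by rewrite -(copy_projl l' mr') (compA sB) -/f' e /f copy_projl.
by rewrite -(copy_projr r' ml') (compA sB) -/f' e /f copy_projr.
Qed.

Lemma spanRel_surj (em : enoughMaps B) (X Y : MapCat B) (R : @hom B X Y) :
  exists s : span X Y, spanRel s = R.
Proof.
have [Z [f [mf Rf]]] := em _ ((R ⊠ idm Y) ;; cup Y).
pose pl := pr1 (MapProducts B) X Y; pose pr := pr2 (MapProducts B) X Y.
pose fa : @arr (MapCat B) Z (prd (MapProducts B) X Y) := exist _ f mf.
exists (Span (fa · pl) (fa · pr)).
rewrite -[LHS]contract_bend /spanRel bend_rel;
  [exact: (proj2_sig (fa · pl)) | exact: (proj2_sig (fa · pr)) |].
have -> : copy Z ;; (proj1_sig (fa · pl) ⊠ proj1_sig (fa · pr)) = f.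
  exact: (f_equal (@proj1_sig _ _) (@pairing_uniq _ (MapProducts B) _ _ _ fa)).
by rewrite -Rf contract_bend.
Qed.

(** The two sides are mates under the adjunctions of [p] and [k]. The converse yields only [q ;; k]
    ≤ [p ;; h], which is an equality because both are maps. *)
Lemma commute_rel (A X Y Z : B) (p : hom A X) (q : hom A Y) (h : hom X Z)
    (k : hom Y Z) :
  is_map p -> is_map q -> is_map h -> is_map k ->
  p ;; h = q ;; k <-> opposite p ;; q ≼ h ;; opposite k.
Proof.
move=> mp mq mh mk.
have [] := (adjoint_opposite mp, adjoint_opposite mk).
move: (opposite p) (opposite k) => p' k' [p1 p2] [k1 k2]; split=> [e|le].
  apply: (hle_trans sB (g := p' ;; (q ;; k ;; k'))).
    apply: comp_monor; rewrite -(compA sB) -[X in X ≼ _](compm1 sB).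
    exact: comp_monor.
  rewrite -e !(compA sB) -[X in _ ≼ X](comp1m sB) -(compA sB _ h).
  exact: comp_monol.
symmetry; apply: map_le_eq; try exact: is_map_comp.
apply: (hle_trans sB (g := p ;; (p' ;; q) ;; k)).
  rewrite -[X in X ≼ _](comp1m sB) !(compA sB) -(compA sB _ q).
  rewrite -(compA sB _ q); exact: comp_monol.
apply: (hle_trans sB (g := p ;; (h ;; k') ;; k)).
  by apply: comp_monol; exact: comp_monor.
rewrite !(compA sB) -(compA sB _ _ k) -[X in _ ≼ X](compm1 sB).
exact: comp_monor.
Qed.

End CartesianBicategory.

(** * Classes of spans, graphs, and choice for spans *)

Lemma class_ext (C : category) (X Y : C) (S T : spanClass X Y) :
  (forall s, S s <-> T s) -> S = T.
Proof.
case: S T => [S hS] [T hT] /= e.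
have {}e : S = T.
  by apply: functional_extensionality => s; exact: propositional_extensionality.
by subst T; rewrite (proof_irrelevance _ hS hT).
Qed.

Lemma class_eq (C : category) (X Y : C) (S T : spanClass X Y) (s : span X Y) :
  S s -> T s -> S = T.
Proof.
have [s0 hS] := members_class S; have [t0 hT] := members_class T.
move=> /hS s0s /hT t0s; apply: class_ext => u; split.
  move=> /hS s0u; apply/hT; apply: spanEqv_trans t0s _.
  by apply: spanEqv_trans s0u; exact: spanEqv_sym.
move=> /hT t0u; apply/hS; apply: spanEqv_trans s0s _.
by apply: spanEqv_trans t0u; exact: spanEqv_sym.
Qed.

Section SpanCategory.

Variables (C : category) (P : finProducts C) (wp : hasWeakPullbacks C).

Let S : cbData := SpanEq P wp.

Lemma classLe_refl (X Y : C) (R : spanClass X Y) : classLe R R.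
Proof.
have [s hs] := members_class R; exists s, s.
have Rs : R s by apply/hs; exact: spanEqv_refl.
by do 2!split=> //; exact: spanLe_refl.
Qed.

Lemma prdm_id (X Y : C) : prdm P (ida X) (ida Y) = ida (prd P X Y).
Proof.
by rewrite /prdm -[RHS](pairing_uniq (f0 := P)) !cmp1a !cmpa1.
Qed.

Lemma graph_comp (X Y Z : C) (f : arr X Y) (g : arr Y Z) :
  classComp wp (graphClass f) (graphClass g) = graphClass (f · g).
Proof.
apply: (class_eq (s := Span (ida X) (f · g))); last exact: spanEqv_refl.
exists (Span (ida X) f), (Span (ida Y) g), (Span (ida X) (f · g)).
split; first exact: spanEqv_refl.
split; first exact: spanEqv_refl.
split; last exact: spanEqv_refl.
(* The square of [f] against an identity is a weak pullback, the mediating arrow being [b]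
   itself. *)
exists (ida X), f; rewrite /= !cmp1a; split; last by [].
split; first by rewrite cmp1a cmpa1.
by move=> T b c; rewrite cmpa1 => <-; exists b; rewrite cmpa1.
Qed.

Lemma graph_tens (X Y X' Y' : C) (f : arr X Y) (g : arr X' Y') :
  classTens P (graphClass f) (graphClass g) = graphClass (prdm P f g).
Proof.
apply: (class_eq (s := Span (ida (prd P X X')) (prdm P f g))).
  exists (Span (ida X) f), (Span (ida X') g).
  split; first exact: spanEqv_refl.
  split; first exact: spanEqv_refl.
  rewrite /spanTens /= prdm_id; exact: spanEqv_refl.
exact: spanEqv_refl.
Qed.

Lemma graph_map (X Y : C) (f : arr X Y) : @is_map S X Y (graphClass f).
Proof.
split; rewrite /single_valued /total /= !graph_comp ?graph_tens ?graph_comp.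
  rewrite /prdm !pairing_comp !cmpA pairing1 pairing2 cmp1a cmpa1.
  exact: classLe_refl.
rewrite (bang_uniq (f · _)); exact: classLe_refl.
Qed.

(* Totality provides a section of the left leg. *)
Lemma span_choice (X Y : S) (R : hom X Y) : total R ->
  exists f : hom X Y, is_map f /\ f ≼ R.
Proof.
move=> [s [t [[[a [a1 _]] _] [[s0 [t0 [v [Rs0 [_ [vc [_ [b [b1 _]]]]]]]]] [c [c1 _]]]]]].
have [p [q [_ [vl _]]]] := vc.
pose d := a · c · b · p.
exists (graphClass (d · legr s0)); split; first exact: graph_map.
exists (Span (ida X) (d · legr s0)), s0; split; first exact: spanEqv_refl.
split=> //; exists d; split=> //=.
by rewrite /d -!cmpA -vl b1 c1 a1.
Qed.

End SpanCategory.

(** * Transport of choice along isomorphisms *)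

Lemma castm_compr (B : cbData) (X Y Z Z' : B) (e : Z = Z') (f : hom X Y) (g : hom Y Z) :
  castm eq_refl e (f ;; g) = f ;; castm eq_refl e g.
Proof. by destruct e. Qed.

Lemma fhom_total (B C : cbData) (F : cbMorphism B C) (X Y : B) (R : hom X Y) :
  total R -> total (fhom F R).
Proof.
move=> /(fhom_le F) /(hle_castm eq_refl (fob_unit F)).
by rewrite fhom_comp castm_compr !fhom_discard.
Qed.

Lemma fhom_is_map (B C : cbData) (F : cbMorphism B C) (X Y : B) (f : hom X Y) :
  is_map f -> is_map (fhom F f).
Proof.
move=> [sf tf]; split; last exact: fhom_total.
move: sf => /(fhom_le F) /(hle_castm eq_refl (fob_tens F Y Y)).
rewrite !fhom_comp (castm_compr _ (fhom F f)) fhom_copy.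
by rewrite -(castm_comp _ (fob_tens F X X)) fhom_copy fhom_tens.
Qed.

(** A map chosen below [fhom F R] is sent back by [G]; the cast identifies [G (F X)] with [X]. *)
Lemma isomorphic_choice (B : cartBicat) (C : cbData) :
  isomorphic B C ->
  (forall (X Y : C) (R : hom X Y), total R ->
     exists f : hom X Y, is_map f /\ f ≼ R) ->
  axiomOfChoice B.
Proof.
move=> [F [G [[e GF] _]]] ac X Y R tR.
have [f [mf fR]] := ac _ _ _ (fhom_total F tR).
exists (castm (e X) (e Y) (fhom G f)); split.
  by apply: is_map_castm; exact: fhom_is_map.
by rewrite -(GF _ _ R); apply: hle_castm; exact: fhom_le.
Qed.

(** * Relations as classes of spans, under choice and enough maps *)

Section Tabulation.

Variables (B : cartBicat) (ac : axiomOfChoice B) (em : enoughMaps B).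

Let cB : isCartBicat B := cb_axioms B.
Let sB : isStrictSMPos B := cB.

(** By [commute_rel], the squares over [h], [k] are the spans denoting a relation below $h;k^{op}$.
    A span denoting exactly that relation must factor through a weak pullback, which forces
    equality. Conversely, [spanLe_rel] turns the inequality into a mediating map. *)
Lemma weakPullback_rel (A X Y Z : MapCat B) (p : arr A X) (q : arr A Y)
    (h : arr X Z) (k : arr Y Z) :
  isWeakPullback p q h k <->
  opposite (proj1_sig p) ;; proj1_sig q =
    proj1_sig h ;; opposite (proj1_sig k).
Proof.
have commE (T : MapCat B) (b : arr T X) (c : arr T Y) : b · h = c · k <->
    opposite (proj1_sig b) ;; proj1_sig c ≼ proj1_sig h ;; opposite (proj1_sig k).
  rewrite -commute_rel; try exact: proj2_sig.
  by split=> [/(f_equal (@proj1_sig _ _))|e] //; exact: mapArr_eq.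
split=> [[/commE le wp]|e].
  apply: (hle_anti sB) => //.
  have [s es] := spanRel_surj em (proj1_sig h ;; opposite (proj1_sig k)).
  have [|t [t1 t2]] := wp _ (legl s) (legr s).
    by apply/commE; rewrite -/(spanRel s) es; exact: (hle_refl sB).
  by rewrite -es -/(spanRel (Span p q)); apply: spanRel_mono; exists t.
split; first by apply/commE; rewrite e; exact: (hle_refl sB).
move=> T b c /commE; rewrite -e -/(spanRel (Span b c)) -/(spanRel (Span p q)).
by move=> /(spanLe_rel ac).
Qed.

Lemma map_weakPullbacks : hasWeakPullbacks (MapCat B).
Proof.
move=> X Y Z h k.
have [[A p q] es] := spanRel_surj em (proj1_sig h ;; opposite (proj1_sig k)).
by exists A, p, q; apply/weakPullback_rel.
Qed.

Lemma rel_class (X Y : MapCat B) (R : @hom B X Y) :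
  exists s, forall t : span X Y, spanRel t = R <-> spanEqv s t.
Proof.
have [s <-] := spanRel_surj em R; exists s => t; split=> [e|/spanRel_eqv //].
by split; apply: (spanLe_rel ac); rewrite e; exact: (hle_refl sB).
Qed.

(** The members are all spans that denote [R], so no representative has to be selected. *)
Definition relClass (X Y : MapCat B) (R : @hom B X Y) : spanClass X Y :=
  SpanClass (rel_class R).

Lemma relClassP (X Y : MapCat B) (R : @hom B X Y) (S : spanClass X Y)
    (s : span X Y) :
  S s -> spanRel s = R -> relClass R = S.
Proof. by move=> Ss e; exact: (class_eq (s := s)). Qed.

Lemma relClass_inj (X Y : MapCat B) (R R' : @hom B X Y) :
  relClass R = relClass R' -> R = R'.
Proof.
have [s <-] := spanRel_surj em R => e.
by have : relClass R' s by rewrite -e.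
Qed.

Lemma relClass_surj (X Y : MapCat B) (S : spanClass X Y) : exists R, relClass R = S.
Proof.
have [s hs] := members_class S; exists (spanRel s).
by apply: relClassP (erefl _); apply/hs; exact: spanEqv_refl.
Qed.

Lemma relClass_le (X Y : MapCat B) (R R' : @hom B X Y) :
  classLe (relClass R) (relClass R') <-> R ≼ R'.
Proof.
split=> [[s [t [<- [<- st]]]]|]; first exact: spanRel_mono.
have [[s <-] [t <-]] := (spanRel_surj em R, spanRel_surj em R').
by move=> /(spanLe_rel ac) st; exists s, t.
Qed.

Lemma relClass_graph (X Y : MapCat B) (f : arr X Y) :
  relClass (proj1_sig f) = graphClass f.
Proof.
apply: (relClassP (S := graphClass f) (spanEqv_refl _)).
by rewrite /spanRel /= opposite_id (comp1m sB).
Qed.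

Lemma relClass_cograph (X Y : MapCat B) (f : arr X Y) :
  relClass (opposite (proj1_sig f)) = cographClass f.
Proof.
apply: (relClassP (S := cographClass f) (spanEqv_refl _)).
by rewrite /spanRel /= (compm1 sB).
Qed.

(** The inner legs of [s] and [t] form the factor $h;k^{op}$ of the composite relation, which
    [weakPullback_rel] replaces by $p^{op};q$. *)
Lemma relClass_comp (wp : hasWeakPullbacks (MapCat B)) (X Y Z : MapCat B)
    (R : @hom B X Y) (R' : @hom B Y Z) :
  relClass (R ;; R') = classComp wp (relClass R) (relClass R').
Proof.
have [[s <-] [t <-]] := (spanRel_surj em R, spanRel_surj em R').
have [A [p [q pq]]] := wp _ _ _ (legr s) (legl t).
apply: (relClassP (s := Span (p · legl s) (q · legr t))).
  exists s, t, (Span (p · legl s) (q · legr t)); do 2!split=> //.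
  by split; [exists p, q | exact: spanEqv_refl].
move/weakPullback_rel: pq; rewrite /spanRel /= opposite_comp; try exact: proj2_sig.
move: (opposite (proj1_sig p)) (opposite (proj1_sig (legl t))) => p' t' e.
move: (opposite _) => s'.
by rewrite -(compA sB s') (compA sB p') e !(compA sB).
Qed.

Lemma prdm_tens (X Y X' Y' : MapCat B) (f : arr X Y) (g : arr X' Y') :
  proj1_sig (prdm (MapProducts B) f g) = proj1_sig f ⊠ proj1_sig g.
Proof.
by rewrite /= (tensm_comp sB) (compA sB) copy_proj (comp1m sB).
Qed.

Lemma relClass_tens (X Y X' Y' : MapCat B) (R : @hom B X Y) (R' : @hom B X' Y') :
  relClass (R ⊠ R') = classTens (MapProducts B) (relClass R) (relClass R').
Proof.
have [[s <-] [t <-]] := (spanRel_surj em R, spanRel_surj em R').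
apply: (relClassP (s := spanTens (MapProducts B) s t)).
  by exists s, t; do 2!split=> //; exact: spanEqv_refl.
rewrite /spanRel [legl _]/= [legr (spanTens _ _ _)]/= !prdm_tens.
rewrite opposite_tens -?(tensm_comp sB) //; exact: proj2_sig.
Qed.

(** Expand the identity as the pairing of the projections; naturality moves the symmetry onto
    [copy], where cocommutativity absorbs it. *)
Lemma sym_proj (X Y : B) : sym X Y = copy (X ⊗ Y) ;; (projr X Y ⊠ projl X Y).
Proof.
rewrite -[LHS](comp1m sB) -copy_proj -(compA sB) (sym_nat sB) (compA sB).
by rewrite (copyC cB).
Qed.

Lemma relClass_sym (X Y : MapCat B) : relClass (sym X Y) =
  graphClass (pairing (MapProducts B) (pr2 (MapProducts B) X Y)
                                      (pr1 (MapProducts B) X Y)).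
Proof. by rewrite sym_proj -relClass_graph. Qed.

Lemma diagE (X : MapCat B) :
  proj1_sig (pairing (MapProducts B) (ida X) (ida X)) = copy X.
Proof. by rewrite /= (tensm_id sB) (compm1 sB). Qed.

Lemma relClass_copy (X : MapCat B) :
  relClass (copy X) = graphClass (pairing (MapProducts B) (ida X) (ida X)).
Proof. by rewrite -diagE relClass_graph. Qed.

Lemma relClass_cocopy (X : MapCat B) :
  relClass (cocopy X) = cographClass (pairing (MapProducts B) (ida X) (ida X)).
Proof. by rewrite -opposite_copy -diagE relClass_cograph. Qed.

Lemma relClass_codiscard (X : MapCat B) :
  relClass (codiscard X) = cographClass (bang (MapProducts B) X).
Proof. by rewrite -opposite_discard -relClass_cograph. Qed.

(** * The isomorphism with the bicategory of spans *)

Variable wp : hasWeakPullbacks (MapCat B).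

Let S : cbData := SpanEq (MapProducts B) wp.

(** Identity on objects, with reflexivity for the object equations, so every cast computes away. *)
Definition toSpan : cbMorphism B S :=
  @CbMorphism B S (fun X => X) relClass
    (fun X Y R R' => proj2 (relClass_le R R'))
    (fun X => relClass_graph (ida (X : MapCat B)))
    (relClass_comp wp)
    (fun X Y => erefl) erefl
    relClass_tens relClass_sym relClass_copy
    (fun X => relClass_graph (bang (MapProducts B) X))
    relClass_cocopy relClass_codiscard.

(** Surjectivity is a mere existence statement, so a description operator is used to obtain the
    morphism; [relClass_inj] makes it unique. *)
Definition classRel (X Y : MapCat B) (T : spanClass X Y) : @hom B X Y :=
  proj1_sig (constructive_indefinite_description _ (relClass_surj T)).

Lemma classRelK (X Y : MapCat B) (T : spanClass X Y) : relClass (classRel T) = T.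
Proof.
exact: (proj2_sig (constructive_indefinite_description _ (relClass_surj T))).
Qed.

Lemma relClassK (X Y : MapCat B) (R : @hom B X Y) : classRel (relClass R) = R.
Proof. by apply: relClass_inj; rewrite classRelK. Qed.

(** Every clause is the corresponding one for [relClass], carried back by its injectivity or, for
    the order, by [relClass_le]. *)
Definition ofSpan : cbMorphism S B.
Proof.
refine (@CbMorphism S B (fun X => X) classRel _ _ _ (fun X Y => erefl) erefl
  _ _ _ _ _ _).
- by move=> X Y T T' le; apply/relClass_le; rewrite !classRelK.
- move=> X; apply: relClass_inj; rewrite classRelK.
  exact: (esym (relClass_graph (ida (X : MapCat B)))).
- move=> X Y Z T T'; apply: relClass_inj.
  by rewrite (relClass_comp wp) !classRelK.
- move=> X Y X' Y' T T'; apply: relClass_inj.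
  by rewrite relClass_tens /= !classRelK.
- by move=> X Y; apply: relClass_inj; rewrite relClass_sym /= classRelK.
- by move=> X; apply: relClass_inj; rewrite relClass_copy /= classRelK.
- move=> X; apply: relClass_inj; rewrite /= classRelK.
  exact: (esym (relClass_graph (bang (MapProducts B) X))).
- by move=> X; apply: relClass_inj; rewrite relClass_cocopy /= classRelK.
- by move=> X; apply: relClass_inj; rewrite relClass_codiscard /= classRelK.
Defined.

Lemma isomorphic_span : isomorphic B S.
Proof.
exists toSpan, ofSpan; split; exists (fun X => erefl).
  exact: relClassK.
exact: classRelK.
Qed.

End Tabulation.

Theorem theorem4p11 (B : cartBicat) (em : enoughMaps B) :
  axiomOfChoice B <->
  exists wp : hasWeakPullbacks (MapCat B),
    isomorphic B (SpanEq (MapProducts B) wp).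
Proof.
split=> [ac|[wp iso]].
  by exists (map_weakPullbacks ac em); exact: isomorphic_span.
by apply: isomorphic_choice iso _ => X Y R; exact: span_choice.
Qed.
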